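(* Let $(\phi,T)$ be a contractive covariant representation of a right LCM dynamical system $(\mathcal{A},P,\alpha)$ and let $K$ be the kernel system associated with $(\phi,T)$. Then $K$ is positive if and only if $\phi$ is completely positive.
   Context: $P$ is a cancellative semigroup with identity $e$ which is right LCM: for all $p,q\in P$ either $pP\cap qP=\emptyset$ or $pP\cap qP=rP$ for some $r\in P$. $\mathcal{A}$ is a unital $\mathrm{C}^*$-algebra and each $\alpha_p$ ($p\in P$) is an injective, not necessarily unital, $*$-endomorphism of $\mathcal{A}$ with $\alpha_p\circ\alpha_q=\alpha_{pq}$, $\alpha_e=\mathrm{id}$. $(\mathcal{A},P,\alpha)$ is a right LCM dynamical system if each $\alpha_p(\mathcal{A})$ is an ideal of $\mathcal{A}$ and, for all $p,q\in P$, $\alpha_p(1)\alpha_q(1)=\alpha_r(1)$ if $pP\cap qP=rP$, and $=0$ if $pP\cap qP=\emptyset$. A contractive covariant representation $(\phi,T)$ on a Hilbert space $\mathcal{H}$ consists of a unital $*$-preserving linear map $\phi:\mathcal{A}\to\mathcal{B}(\mathcal{H})$ and a unital semigroup homomorphism $T:P\to\mathcal{B}(\mathcal{H})$ with contractive values such that $T(p)\phi(a)T(p)^*=\phi(\alpha_p(a))$ for all $p\in P$, $a\in\mathcal{A}$. Put $\mathcal{A}_{p,q}=\alpha_p(1)\mathcal{A}\alpha_q(1)$ (which here equals $\alpha_p(\mathcal{A})\cap\alpha_q(\mathcal{A})$, and equals $\alpha_r(\mathcal{A})$ when $pP\cap qP=rP$) and $\Lambda=\{(p,a,q):p,q\in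 P,\ a\in\mathcal{A}_{p,q}\}$. For $r\in pP$, $p^{-1}r$ denotes the unique $x\in P$ with $px=r$. The kernel system associated with $(\phi,T)$ is the (well-defined) map $K:\Lambda\to\mathcal{B}(\mathcal{H})$, \[K(p,a,q)=\begin{cases}T(p^{-1}r)\,\phi(\alpha_r^{-1}(a))\,T(q^{-1}r)^*,& \text{if } pP\cap qP=rP;\\ 0,& \text{if } pP\cap qP=\emptyset.\end{cases}\] $K$ is positive if for all $p_1,\dots,p_n\in P$ and $a_i\in\mathcal{A}\alpha_{p_i}(1)$, the operator matrix $[K(p_i,a_i^*a_j,p_j)]_{i,j}$ is positive (semidefinite) on $\mathcal{H}^n$. *)

(* Defs.v *)
From HB Require Import structures.
From mathcomp Require Import all_boot all_order all_algebra.
From mathcomp Require Import complex.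
From mathcomp Require Import all_classical all_reals all_analysis.

Set Implicit Arguments.
Unset Strict Implicit.
Unset Printing Implicit Defensive.

Import Order.TTheory GRing.Theory Num.Theory.
Import numFieldNormedType.Exports.

Local Open Scope classical_set_scope.
Local Open Scope ring_scope.
Local Open Scope complex_scope.

(* The norms below take their values in R[i], where 0 <= z means that z is real
   and nonnegative. *)

(* A unital C*-algebra is a Banach space with a product and an involution.  The
   ring operations are part of the mixin because ring structures and normed
   modules have no common join in the hierarchy; the ring structure itself is
   declared right after. *)
HB.mixin Record isCStarAlgebra (R : realType) A
    of CompleteNormedModule R[i] A := {
  cstar_one : A;
  cstar_mul : A -> A -> A;
  cstar_mulA : associative cstar_mul;
  cstar_mul1l : left_id cstar_one cstar_mul;
  cstar_mul1r : right_id cstar_one cstar_mul;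
  cstar_mulDl : left_distributive cstar_mul +%R;
  cstar_mulDr : right_distributive cstar_mul +%R;
  cstar_scaleAl : forall (c : R[i]) (a b : A),
    c *: cstar_mul a b = cstar_mul (c *: a) b;
  cstar_scaleAr : forall (c : R[i]) (a b : A),
    c *: cstar_mul a b = cstar_mul a (c *: b);
  star : A -> A;
  starD : {morph star : a b / a + b};
  starZ : forall (c : R[i]) (a : A), star (c *: a) = Num.conj c *: star a;
  starM : forall a b : A, star (cstar_mul a b) = cstar_mul (star b) (star a);
  starK : involutive star;
  cstar_normM : forall a b : A, `|cstar_mul a b| <= `|a| * `|b|;
  cstar_norm_star : forall a : A, `|cstar_mul (star a) a| = `|a| ^+ 2
}.

#[short(type="cstarAlgType")]
HB.structure Definition CStarAlgebra (R : realType) :=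
  {A of CompleteNormedModule R[i] A & isCStarAlgebra R A}.

HB.instance Definition _ (R : realType) (A : cstarAlgType R) :=
  GRing.Zmodule_isPzRing.Build (CStarAlgebra.sort A)
    cstar_mulA cstar_mul1l cstar_mul1r cstar_mulDl cstar_mulDr.

(* dotp is linear in its first argument and conjugate-linear in the second. *)
HB.mixin Record isHilbert (R : realType) H of CompleteNormedModule R[i] H := {
  dotp : {dot H for Num.conj};
  dotp_norm : forall x : H, dotp x x = `|x| ^+ 2
}.

#[short(type="hilbertType")]
HB.structure Definition Hilbert (R : realType) :=
  {H of CompleteNormedModule R[i] H & isHilbert R H}.

Section BoundedOperators.
Context (R : realType) (H : hilbertType R).

Definition is_bounded_operator (f : H -> H) : Prop :=
  linear f /\ exists M : R[i], forall x, `|f x| <= M * `|x|.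

Definition bounded_operator : {pred H -> H} :=
  fun f => `[< is_bounded_operator f >].

Lemma bounded_operator_submod_closed : submod_closed bounded_operator.
Proof.
split=> [|c f g /asboolP[lf [M fM]] /asboolP[lg [N gN]]]; apply/asboolP; split.
- by move=> c x y; rewrite /= scaler0 addr0.
- by exists 0 => x; rewrite normr0 mul0r.
- move=> d x y; rewrite -[LHS]/(c *: f _ + g _) lf lg.
  rewrite -[(c *: f + g) x]/(c *: f x + g x) -[(c *: f + g) y]/(c *: f y + g y).
  by rewrite !scalerDr !scalerA (mulrC c d) addrACA.
- exists (`|c| * M + N) => x; rewrite -[X in `|X|]/(c *: f x + g x).
  rewrite (le_trans (ler_normD _ _))// mulrDl lerD// normrZ -mulrA.
  by rewrite ler_wpM2l.
Qed.

HB.instance Definition _ :=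
  GRing.isSubmodClosed.Build _ _ bounded_operator bounded_operator_submod_closed.

Record bop := Bop { bop_fun :> H -> H; _ : bop_fun \in bounded_operator }.

HB.instance Definition _ := [isSub for bop_fun].
HB.instance Definition _ := [Choice of bop by <:].
HB.instance Definition _ := [SubChoice_isSubLmodule of bop by <:].

Lemma bopP (S : bop) : is_bounded_operator S.
Proof. by case: S => f /= /asboolP. Qed.

Lemma bop_id_subproof : idfun \in bounded_operator.
Proof.
apply/asboolP; split=> [c x y//|]; exists 1 => x; by rewrite mul1r.
Qed.

Lemma bop_comp_subproof (S S' : bop) : S \o S' \in bounded_operator.
Proof.
have [lS [M SM]] := bopP S; have [lS' [M' SM']] := bopP S'.
apply/asboolP; split=> [c x y|].
  by rewrite -[LHS]/(S (S' (c *: x + y))) lS' lS.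
have [M0|M0] := boolP (0 <= M).
  exists (M * M') => x; rewrite -mulrA.
  by apply: le_trans (SM _) _; rewrite ler_wpM2l.
exists 0 => x; rewrite mul0r -[X in `|X|]/(S (S' x)).
have [->|Sx0] := eqVneq (S (S' x)) 0; first by rewrite normr0.
have S'x0 : 0 < `|S' x|.
  rewrite normr_gt0; apply: contra_neq Sx0 => ->.
  by have := SM 0; rewrite normr0 mulr0 normr_le0 => /eqP.
have := le_trans (normr_ge0 _) (SM (S' x)).
by rewrite pmulr_lge0// (negbTE M0).
Qed.

Definition bop_id : bop := Bop bop_id_subproof.
Definition bop_comp (S S' : bop) : bop := Bop (bop_comp_subproof S S').

Fact bop_compA : associative bop_comp.
Proof. by move=> S S' S''; apply/val_inj. Qed.
Fact bop_comp1l : left_id bop_id bop_comp.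
Proof. by move=> S; apply/val_inj. Qed.
Fact bop_comp1r : right_id bop_id bop_comp.
Proof. by move=> S; apply/val_inj. Qed.
Fact bop_compDl : left_distributive bop_comp +%R.
Proof. by move=> S S' S''; apply/val_inj. Qed.
Fact bop_compDr : right_distributive bop_comp +%R.
Proof.
move=> S S' S''; apply/val_inj/funext => x.
have [lS _] := bopP S.
rewrite -[LHS]/(S (S' x + S'' x)) -[RHS]/(S (S' x) + S (S'' x)).
by have := lS 1 (S' x) (S'' x); rewrite !scale1r.
Qed.

(* The product of B(H) is composition; H may be the zero space, hence a
   PzRing. *)
HB.instance Definition _ := GRing.Zmodule_isPzRing.Build bop
  bop_compA bop_comp1l bop_comp1r bop_compDl bop_compDr.

(* The adjoint exists and is unique by the Riesz representation theorem. *)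
Definition adj (S : bop) : bop :=
  xget 0 [set S' : bop | forall x y : H, dotp (S x) y = dotp x (S' y)].

(* Positivity of a matrix of operators, as an operator on H^n with its Hilbert
   sum inner product. *)
Definition op_mx_positive (n : nat) (S : 'M[bop]_n) : Prop :=
  forall h : 'I_n -> H, 0 <= \sum_i dotp (\sum_j S i j (h j)) (h i).

End BoundedOperators.

Notation "''B' ( H )" := (bop H) (at level 8, format "''B' ( H )") : type_scope.

Section CompletelyPositive.
Context (R : realType) (A : cstarAlgType R) (H : hilbertType R).

Definition star_mx (m n : nat) (X : 'M[A]_(m, n)) : 'M[A]_(n, m) :=
  map_mx star X^T.

Definition mx_positive (n : nat) (X : 'M[A]_n) : Prop :=
  exists Y : 'M[A]_n, X = star_mx Y *m Y.

Definition completely_positive (phi : A -> 'B(H)) : Prop :=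
  forall (n : nat) (X : 'M[A]_n), mx_positive X ->
    op_mx_positive (map_mx phi X).

End CompletelyPositive.

Section RightLCM.
Context (P : monoidType).

Definition cancellative : Prop :=
  (forall p : P, injective (fun x => p * x)%g) /\
  (forall p : P, injective (fun x => x * p)%g).

Definition right_ideal (p : P) : set P := [set (p * x)%g | x in [set: P]].

Definition right_LCM : Prop := forall p q : P,
  right_ideal p `&` right_ideal q = set0 \/
  exists r, right_ideal p `&` right_ideal q = right_ideal r.

(* A generator r of pP `&` qP when there is one; it is unique only up to right
   multiplication by a unit. *)
Definition lcm_of (p q : P) : P :=
  xget 1%g [set r | right_ideal p `&` right_ideal q = right_ideal r].

(* p^-1 r, for r in pP *)
Definition ldiv (p r : P) : P := xget 1%g [set x | (p * x)%g = r].

End RightLCM.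

Arguments cancellative : clear implicits.
Arguments right_LCM : clear implicits.

Definition two_sided_ideal (R : realType) (A : cstarAlgType R) (I : set A) :
    Prop :=
  [/\ I 0, forall a b, I a -> I b -> I (a + b),
      forall (c : R[i]) a, I a -> I (c *: a),
      forall a b, I b -> I (a * b) & forall a b, I a -> I (a * b)].

Record right_LCM_dynamical_system (R : realType) (A : cstarAlgType R)
    (P : monoidType) (alpha : P -> {linear A -> A}) : Prop := {
  rlcm_cancellative : cancellative P;
  rlcm_right_LCM : right_LCM P;
  rlcm_mul : forall p a b, alpha p (a * b) = alpha p a * alpha p b;
  rlcm_star : forall p a, alpha p (star a) = star (alpha p a);
  rlcm_inj : forall p, injective (alpha p);
  rlcm_comp : forall p q a, alpha p (alpha q a) = alpha (p * q)%g a;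
  rlcm_id : forall a, alpha 1%g a = a;
  rlcm_ideal : forall p, two_sided_ideal (range (alpha p));
  rlcm_lcm : forall p q r,
    right_ideal p `&` right_ideal q = right_ideal r ->
    alpha p 1 * alpha q 1 = alpha r 1;
  rlcm_disjoint : forall p q, right_ideal p `&` right_ideal q = set0 ->
    alpha p 1 * alpha q 1 = 0
}.

Record contractive_covariant_representation (R : realType)
    (A : cstarAlgType R) (P : monoidType) (alpha : P -> {linear A -> A})
    (H : hilbertType R) (phi : {linear A -> 'B(H)}) (T : P -> 'B(H)) :
    Prop := {
  ccr_unital : phi 1 = 1;
  ccr_star : forall a, phi (star a) = adj (phi a);
  ccr_T1 : T 1%g = 1;
  ccr_TM : forall p q, T (p * q)%g = T p * T q;
  ccr_contractive : forall p (x : H), `|T p x| <= `|x|;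
  ccr_covariant : forall p a, T p * phi a * adj (T p) = phi (alpha p a)
}.

Section KernelSystem.
Context (R : realType) (A : cstarAlgType R) (P : monoidType).
Context (alpha : P -> {linear A -> A}) (H : hilbertType R).
Context (phi : {linear A -> 'B(H)}) (T : P -> 'B(H)).

Definition alpha_inv (r : P) (a : A) : A := xget 0 [set b | alpha r b = a].

(* K is total in a; it is only meaningful for a in alpha_p(1) A alpha_q(1),
   which is the range of alpha_r when pP `&` qP = rP. *)
Definition kernel_system (p : P) (a : A) (q : P) : 'B(H) :=
  if `[< right_ideal p `&` right_ideal q = set0 >] then 0
  else let r := lcm_of p q in
    T (ldiv p r) * phi (alpha_inv r a) * adj (T (ldiv q r)).

(* The entries below lie in the domain of K: if a_i is in A alpha_(p_i)(1),
   then a_i^* a_j is in alpha_(p_i)(1) A alpha_(p_j)(1). *)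
Definition kernel_positive (K : P -> A -> P -> 'B(H)) : Prop :=
  forall (n : nat) (p : 'I_n -> P) (a : 'I_n -> A),
    (forall i, exists b, a i = b * alpha (p i) 1) ->
    op_mx_positive (\matrix_(i, j) K (p i) (star (a i) * a j) (p j)).

End KernelSystem.

(* Main.v *)
Require Import Defs.
From mathcomp Require Import all_boot all_order all_algebra.
From mathcomp Require Import complex ring lra.
From mathcomp Require Import all_classical all_reals all_analysis.

(** Complete positivity of [phi] is the same as positivity of all the Gram
    matrices [phi (b_i^* b_j)], because [Y^* Y] is the sum over its rows of
    such matrices ([completely_positive_gram]).  Since [K 1 a 1 = phi a], a
    positive kernel gives the Gram condition by taking every [p_i] to be [1].

    Conversely, let [p_i] and [a_i] be given.  As each [alpha_p(A)] is an ideal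
    with unit [E_p := alpha_p(1)], the [E_p] are commuting central projections
    of [A], and the right LCM condition says that they multiply as the right
    ideals [pP] intersect.  They cut [1] into finitely many atoms; on a nonzero
    atom [e] those [p_i] with [E_(p_i) e <> 0] have a common right multiple [r]
    with [e <= E_r].  Then [e a_i = alpha_r(b_i)], with [b_i = 0] for the other
    indices, and the kernel does not depend on which common multiple is used to
    compute it ([kernel_system_alpha], which is where covariance enters), so
    that [K(p_i, e a_i^* a_j, p_j) = S_i phi(b_i^* b_j) S_j^*] with
    [S_i := T(p_i^-1 r)].  The part of the quadratic form of [K] carried by [e]
    is therefore the form of the Gram matrix [phi(b_i^* b_j)] at the vectors
    [S_i^* h_i], and so is nonnegative ([compressed_form_atom]).  The form is
    additive in [e], and [compressed_form_ge0] refines [1] into atoms one [p_i]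
    at a time.

    The argument uses that every bounded operator [S] has a true adjoint
    satisfying [(S S')^* = S'^* S^*].  This rests on the Riesz representation
    theorem, whose vector is found by minimizing [|x|^2 - 2 Re f(x)]. *)

Set Implicit Arguments.
Unset Strict Implicit.
Unset Printing Implicit Defensive.

Import Order.TTheory GRing.Theory Num.Theory.
Import numFieldNormedType.Exports.

Local Open Scope classical_set_scope.
Local Open Scope ring_scope.
Local Open Scope complex_scope.

(** * The real inner product of a complex Hilbert space *)

Section RealHilbert.
Context (R : realType) (H : hilbertType R).
Implicit Types (x y z : H) (t : R).

(** The norm and the inner product take their values in [R[i]]; the variational
    argument below needs an ordered field with infima, hence these real
    counterparts. *)
Definition real_norm x : R := complex.Re `|x|.
Definition real_dotp x y : R := complex.Re (dotp x y).

Lemma real_normE x : `|x| = (real_norm x)%:C.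
Proof. by rewrite RRe_real// normr_real. Qed.

Lemma real_norm_ge0 x : 0 <= real_norm x.
Proof. by rewrite -ler0c -real_normE. Qed.

Lemma real_norm_eq0 x : real_norm x = 0 -> x = 0.
Proof. by move=> x0; apply/eqP; rewrite -normr_eq0 real_normE x0. Qed.

Lemma real_dotpxx x : real_dotp x x = real_norm x ^+ 2.
Proof. by rewrite /real_dotp dotp_norm real_normE -rmorphXn. Qed.

Lemma dotpC x y : dotp x y = Num.conj (dotp y x).
Proof. by rewrite (@hermC _ _ Num.conj _ (@dotp R H)) expr0 mul1r. Qed.

Lemma real_dotpC x y : real_dotp x y = real_dotp y x.
Proof. by rewrite /real_dotp dotpC; case: (dotp y x). Qed.

Lemma real_dotpDl x y z : real_dotp (x + y) z = real_dotp x z + real_dotp y z.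
Proof. by rewrite /real_dotp linearDl raddfD. Qed.

Lemma Re_realM t (c : R[i]) : complex.Re (t%:C * c) = t * complex.Re c.
Proof. by case: c => a b /=; rewrite mul0r subr0. Qed.

Lemma real_dotpZl t x z : real_dotp (t%:C *: x) z = t * real_dotp x z.
Proof. by rewrite /real_dotp linearZl_LR Re_realM. Qed.

Lemma real_dotpDr x y z : real_dotp z (x + y) = real_dotp z x + real_dotp z y.
Proof. by rewrite real_dotpC real_dotpDl !(real_dotpC z). Qed.

Lemma real_dotpZr t x z : real_dotp z (t%:C *: x) = t * real_dotp z x.
Proof. by rewrite real_dotpC real_dotpZl real_dotpC. Qed.

Lemma real_norm_sqrDZ x z s t :
  real_norm (s%:C *: x + t%:C *: z) ^+ 2 =
  s ^+ 2 * real_norm x ^+ 2 + 2 * s * t * real_dotp x z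
    + t ^+ 2 * real_norm z ^+ 2.
Proof.
rewrite -!real_dotpxx !(real_dotpDl, real_dotpDr, real_dotpZl, real_dotpZr).
rewrite (real_dotpC z x); ring.
Qed.

(** Expand the square norm of [|y| x - |x| y], which is nonnegative. *)
Lemma real_CauchySchwarz x y : real_dotp x y <= real_norm x * real_norm y.
Proof.
have [y0|y0] := eqVneq (real_norm y) 0.
  by rewrite y0 (real_norm_eq0 y0) /real_dotp linear0r mulr0.
have [x0|x0] := eqVneq (real_norm x) 0.
  by rewrite x0 (real_norm_eq0 x0) /real_dotp linear0l mul0r.
have xy0 : 0 < real_norm x * real_norm y.
  by rewrite mulr_gt0// lt_neqAle eq_sym real_norm_ge0 ?x0 ?y0.
have := sqr_ge0 (real_norm
  ((real_norm y)%:C *: x + (- real_norm x)%:C *: y)).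
rewrite real_norm_sqrDZ => h.
rewrite -(ler_pM2l xy0); nra.
Qed.

End RealHilbert.

(** * Riesz representation and adjoints *)

Section Riesz.
Context (R : realType) (H : hilbertType R).
Variables (f : H -> R[i]) (c : R).
Hypothesis f_lin : scalar f.
Hypothesis f_bnd : forall x, complex.Re (f x) <= c * real_norm x.
Implicit Types (x y z : H) (s t e : R).

Let g x : R := complex.Re (f x).
Let J x : R := real_norm x ^+ 2 - 2 * g x.
Let m : R := inf (range J).

Let f0 : f 0 = 0.
Proof.
have := f_lin (-1) 0 0.
by rewrite scaler0 addr0 => ->; rewrite mulN1r addNr.
Qed.

Let gDZ s t x z : g (s%:C *: x + t%:C *: z) = s * g x + t * g z.
Proof.
rewrite /g -[t%:C *: z]addr0 !f_lin.
by rewrite f0 addr0 raddfD/= !Re_realM.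
Qed.

Let J_has_inf : has_inf (range J).
Proof.
split; first by exists (J 0), 0.
exists (- c ^+ 2) => _ [x _ <-]; have := f_bnd x.
rewrite /J -/(g x) => h; have := sqr_ge0 (real_norm x - c); nra.
Qed.

Let le_inf_J x : m <= J x.
Proof. by apply: ge_inf; [case: J_has_inf|exists x]. Qed.

(** The parallelogram identity, applied to the midpoint of [x] and [y]. *)
Let near_min_close x y e : J x < m + e -> J y < m + e ->
  real_norm (x - y) ^+ 2 < 4 * e.
Proof.
move=> Jx Jy; have := le_inf_J ((2^-1 : R)%:C *: x + (2^-1 : R)%:C *: y).
move: Jx Jy; rewrite /J real_norm_sqrDZ gDZ.
have := real_norm_sqrDZ x y 1 (-1).
by rewrite rmorphN1 scaleN1r rmorph1 scale1r => ->; lra.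
Qed.

(** The near-minimizers form a Cauchy filter.  Having near-minimizers
    arbitrarily close to its limit replaces the continuity of [J]. *)
Let min_limit : exists u, forall e, 0 < e ->
  exists2 x, real_norm (x - u) < e & J x < m + e.
Proof.
pose B e := [set x | J x < m + e].
pose F := filter_from [set e : R | 0 < e] B.
have B_nonempty e : 0 < e -> exists x, B e x.
  by move=> e0; have [_ [x _ <-] ?] := inf_adherent e0 J_has_inf; exists x.
have B_min d e : B (Num.min d e) `<=` B d `&` B e.
  move=> x; rewrite /B/= => h.
  by split; apply: (lt_le_trans h); rewrite lerD2l ge_min lexx ?orbT.
have FF : ProperFilter F.
  apply: filter_from_proper => [|e /B_nonempty//].
  apply: filter_from_filter; first by exists 1; rewrite /= ltr01.
  move=> d e d0 e0; exists (Num.min d e); last exact: B_min.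
  by rewrite /= lt_min d0.
have normB_lt x y (e : R[i]) : 0 < e -> real_norm (x - y) < complex.Re e ->
    `|x - y| < e.
  by move=> /gtr0_real/RRe_real {2}<- h; rewrite real_normE ltcR.
have Re_gt0 (e : R[i]) : 0 < e -> 0 < complex.Re e.
  by rewrite ltcE => /andP[].
have F_cauchy : cauchy F.
  apply: cauchy_exP => e e0; have r0 := Re_gt0 _ e0.
  have d0 : 0 < (complex.Re e) ^+ 2 / 4 by rewrite divr_gt0// exprn_gt0.
  have [x Bx] := B_nonempty _ d0.
  exists x; exists ((complex.Re e) ^+ 2 / 4) => // y By.
  rewrite -ball_normE /=; apply: normB_lt => //.
  rewrite -ltr_sqr ?nnegrE ?real_norm_ge0 ?(ltW r0)//.
  by have := near_min_close Bx By; rewrite mulrC divfK.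
have Fu := @cauchy_cvg _ F FF F_cauchy.
exists (lim F) => e e0.
have e0' : 0 < e%:C by rewrite ltcR.
have [d d0 du] := Fu _ (nbhsx_ballx (lim F) _ e0').
have [|x Bx] := B_nonempty (Num.min d e); first by rewrite lt_min d0.
have [Bd Be] := B_min _ _ _ Bx.
exists x => //.
by have := du _ Bd; rewrite -ball_normE /= distrC real_normE ltcR.
Qed.

(** The Euler equation of the minimum of [J]: moving a near-minimizer by
    [- s e z] with [s = 1] or [s = -1] cannot decrease [J] below its infimum, so
    that the derivative of [J] at the limit in the direction [z] is at most a
    multiple of [e]. *)
Lemma Riesz_representation_real : exists u, forall z, g z = real_dotp z u.
Proof.
have [u u_lim] := min_limit; exists u => z.
pose D := real_dotp z u - g z.
suff D0 : D = 0 by rewrite -[RHS](subrK (g z)) -/D D0 add0r.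
(* [K] collects the three errors of order [e ^+ 2]: the second-order term, the
   distance from [x] to [u], and the excess of [J x] over the infimum. *)
pose K := real_norm z ^+ 2 + 2 * real_norm z + 1.
have nz := real_norm_ge0 z.
have D_le s e : s ^+ 2 = 1 -> 0 < e -> 2 * (s * D) <= e * K.
  move=> s1 e0; have e20 : 0 < e ^+ 2 by rewrite exprn_gt0.
  have [|x xu Jx] := u_lim (Num.min e (e ^+ 2)); first by rewrite lt_min e0.
  have {}xu : real_norm (x - u) < e.
    by apply: lt_le_trans xu _; rewrite ge_min lexx.
  have {}Jx : J x < m + e ^+ 2.
    by apply: lt_le_trans Jx _; rewrite lerD2l ge_min lexx orbT.
  have := le_inf_J ((1:R)%:C *: x + (- s * e)%:C *: z).
  rewrite /J real_norm_sqrDZ gDZ.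
  have CS := real_CauchySchwarz ((- s)%:C *: z) (x - u).
  have wz : real_norm ((- s)%:C *: z) = real_norm z.
    apply/eqP; rewrite -(@eqrXn2 _ 2) ?real_norm_ge0//.
    rewrite -!real_dotpxx real_dotpZl real_dotpZr mulrA -expr2 sqrrN s1.
    by rewrite mul1r.
  have zxu : real_dotp z (x - u) = real_dotp x z - real_dotp z u.
    by rewrite /real_dotp linearBr raddfB/= -!/(real_dotp _ _) real_dotpC.
  move: CS Jx; rewrite wz real_dotpZl zxu /J exprMn sqrrN s1 => CS Jx mJ.
  have zxu_le : real_norm z * real_norm (x - u) <= real_norm z * e.
    by rewrite ler_wpM2l// ltW.
  have := ler_wpM2l (ltW e0) (le_trans CS zxu_le) => eCS.
  rewrite -(ler_pM2l e0) /D /K; lra.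
have K0 : 0 < K by rewrite /K; have := sqr_ge0 (real_norm z); lra.
have not_gt0 s : s ^+ 2 = 1 -> ~~ (0 < s * D).
  move=> s1; apply/negP => sD; have := D_le s _ s1 (divr_gt0 sD K0).
  by rewrite divfK ?gt_eqF//; lra.
apply/eqP; rewrite eq_le; apply/andP; split; rewrite leNgt.
  by have := not_gt0 1; rewrite mul1r expr1n; apply.
by have := not_gt0 (-1); rewrite mulN1r oppr_gt0 sqrrN expr1n; apply.
Qed.

(** The imaginary parts agree as well since [Re ('i c) = - Im c]. *)
Theorem Riesz_representation : exists u, forall z, f z = dotp z u.
Proof.
have [u gE] := Riesz_representation_real; exists u => z.
have Im_eq : complex.Im (f z) = complex.Im (dotp z u).
  have := gE ('i *: z); rewrite /g /real_dotp.
  rewrite -[_ *: z]addr0 f_lin linearDl linearZl_LR linear0l.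
  by rewrite f0 !addr0 !(mulrC 'i) !ReiNIm => /oppr_inj.
have := gE z; rewrite /g /real_dotp.
by case: (f z) (dotp z u) Im_eq => ? ? [? ?] /= -> ->.
Qed.

End Riesz.

Section Adjoint.
Context (R : realType) (H : hilbertType R).
Implicit Types (S : 'B(H)) (x y z : H).

Lemma dotp_injr y z : (forall x, dotp x y = dotp x z) -> y = z.
Proof.
move=> yz; apply/eqP; rewrite -subr_eq0 -normr_eq0 -sqrf_eq0 -dotp_norm.
by rewrite linearBr/= yz subrr.
Qed.

Lemma real_norm_bop S :
  exists2 M : R, 0 <= M & forall x, real_norm (S x) <= M * real_norm x.
Proof.
have [_ [M SM]] := bopP S; exists `|complex.Re M| => // x.
have := SM x; rewrite !real_normE lecE => /andP[_ /=].
rewrite mulrC Re_realM mulrC => /le_trans; apply.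
by rewrite ler_wpM2r ?real_norm_ge0 ?ler_norm.
Qed.

(** [adj S] is a choice among the operators satisfying this identity, so the
    point is that one exists: Riesz gives it as a function [S'], which
    is linear because the identity determines it, and bounded because
    [|S' v|^2 = <S (S' v), v>]. *)
Lemma adjP S x y : dotp (S x) y = dotp x (adj S y).
Proof.
suff [S' S'P] : exists S' : 'B(H), forall x y, dotp (S x) y = dotp x (S' y).
  have : [set S' : 'B(H) | forall x y, dotp (S x) y = dotp x (S' y)] (adj S).
    by apply: xgetPex; exists S'.
  by apply.
have [S_lin _] := bopP S; have [M M0 SM] := real_norm_bop S.
have ex_S' z : exists u, forall x, dotp (S x) z = dotp x u.
  apply: (@Riesz_representation _ _ (fun x => dotp (S x) z) (M * real_norm z)).
    by move=> a v w /=; rewrite S_lin linearDl linearZl_LR.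
  move=> v; apply: le_trans (real_CauchySchwarz _ _) _.
  by rewrite mulrAC ler_wpM2r ?real_norm_ge0.
have [S' S'P] := choice ex_S'.
suff S'b : S' \in @bounded_operator R H by exists (Bop S'b) => v w; exact: S'P.
apply/asboolP; split.
  move=> a v w; apply: dotp_injr => t.
  by rewrite -S'P !linearDr !linearZr_LR/= -!S'P.
exists M%:C => v; rewrite !real_normE -rmorphM lecR.
have [->|v0] := eqVneq (real_norm (S' v)) 0.
  by rewrite mulr_ge0// real_norm_ge0.
have S'v0 : 0 < real_norm (S' v) by rewrite lt_def v0 real_norm_ge0.
rewrite -(ler_pM2l S'v0) -expr2 -real_dotpxx.
rewrite {1}/real_dotp -S'P; apply: le_trans (real_CauchySchwarz _ _) _.
by rewrite mulrA ler_wpM2r ?real_norm_ge0// mulrC.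
Qed.

Lemma adjM S S' : adj (S * S') = adj S' * adj S.
Proof.
apply/val_inj/funext => y; apply: dotp_injr => x.
by rewrite /= -!adjP.
Qed.

End Adjoint.

Section BopEval.
Context (R : realType) (H : hilbertType R).
Implicit Types (S : 'B(H)) (x : H).

Lemma bop_eval_sum (I : Type) (s : seq I) (S : I -> 'B(H)) x :
  (\sum_(k <- s) S k) x = \sum_(k <- s) S k x.
Proof. by elim/big_rec2: _ => // k y z _ <-. Qed.

Lemma bop_sum (I : Type) (s : seq I) S (x : I -> H) :
  S (\sum_(k <- s) x k) = \sum_(k <- s) S (x k).
Proof.
have [S_lin _] := bopP S.
elim/big_rec2: _ => [|k y z _ <-]; last by rewrite -[x k]scale1r S_lin !scale1r.
by have := S_lin (-1) 0 0; rewrite scaler0 addr0 => ->; rewrite scaleN1r addNr.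
Qed.

Lemma adj1 : adj 1 = 1 :> 'B(H).
Proof. by apply/val_inj/funext => y; apply: dotp_injr => x; rewrite -adjP. Qed.

End BopEval.

(** * Central projections of a C*-algebra *)

Section CentralProjections.
Context (R : realType) (A : cstarAlgType R).
Implicit Types a b e f : A.

Lemma star0 : star 0 = 0 :> A.
Proof. by have := starZ 0 (0 : A); rewrite !scale0r rmorph0 scale0r. Qed.

Lemma star_mul a b : star (a * b) = star b * star a.
Proof. exact: starM. Qed.

Lemma star1 : star 1 = 1 :> A.
Proof. by have := star_mul (star 1) 1; rewrite !mulr1 starK mulr1. Qed.

Lemma starB a b : star (a - b) = star a - star b.
Proof. by rewrite starD -scaleN1r starZ rmorphN1 scaleN1r. Qed.

Definition central_projection e : Prop :=
  [/\ e * e = e, star e = e & forall a, e * a = a * e].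

Lemma central_projection0 : central_projection (0 : A).
Proof. by split; rewrite ?mulr0 ?star0// => c; rewrite mulr0 mul0r. Qed.

Lemma central_projectionM e f : central_projection e ->
  central_projection f -> central_projection (e * f).
Proof.
move=> [ee es ec] [ff fs fc]; split.
- by rewrite mulrA -(mulrA e) -ec !mulrA ee -mulrA ff.
- by rewrite star_mul es fs ec.
- by move=> b; rewrite -mulrA fc mulrA ec mulrA.
Qed.

Lemma central_projectionB e f : central_projection e ->
  central_projection f -> f * e = f -> central_projection (e - f).
Proof.
move=> [ee es ec] [ff fs fc] fe; split.
- by rewrite mulrBl !mulrBr ee ff ec fe subrr subr0.
- by rewrite starB es fs.
- by move=> b; rewrite mulrBl mulrBr ec fc.
Qed.

End CentralProjections.

(** * Complete positivity through Gram matrices *)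

Section GramForm.
Context (R : realType) (A : cstarAlgType R) (H : hilbertType R).
Variable phi : {linear A -> 'B(H)}.

Definition gram_positive : Prop :=
  forall n (b : 'I_n -> A) (h : 'I_n -> H),
  0 <= \sum_i dotp (\sum_j phi (star (b i) * b j) (h j)) (h i).

(** [Y^* Y] is the sum over the rows of [Y] of Gram matrices; conversely a Gram
    matrix is [Y^* Y] for [Y] with [b] as first row and zeros elsewhere. *)
Lemma completely_positive_gram : completely_positive phi <-> gram_positive.
Proof.
split=> [phi_cp [|n] b h|phi_gram n X [Y ->] h]; first by rewrite big_ord0.
  pose Y : 'M[A]_n.+1 := \matrix_(k, j) if k == 0 then b j else 0.
  have := phi_cp _ _ (ex_intro _ Y erefl) h.
  congr (_ <= _); apply: eq_bigr => i _; congr (dotp _ _).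
  apply: eq_bigr => j _; rewrite mxE; congr (bop_fun (phi _) _).
  rewrite mxE big_ord_recl !mxE eqxx big1 ?addr0// => k _.
  by rewrite !mxE /= star0 mul0r.
suff -> : \sum_i dotp (\sum_j (map_mx phi (star_mx Y *m Y)) i j (h j)) (h i) =
    \sum_k \sum_i dotp (\sum_j phi (star (Y k i) * Y k j) (h j)) (h i).
  by apply: sumr_ge0 => k _; exact: phi_gram.
rewrite exchange_big; apply: eq_bigr => i _ /=.
rewrite -linear_sumlz/= exchange_big; congr (dotp _ _).
apply: eq_bigr => j _ /=; rewrite !mxE raddf_sum bop_eval_sum.
by apply: eq_bigr => k _; rewrite !mxE.
Qed.

End GramForm.

(** * Principal right ideals *)

Section RightIdeals.
Context (P : monoidType).
Implicit Types p q r x : P.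

Lemma right_idealP p r : right_ideal p r <-> exists x, (p * x)%g = r.
Proof. by split=> [[x _ <-]|[x <-]]; exists x. Qed.

Lemma mul_ldiv p r : right_ideal p r -> (p * ldiv p r)%g = r.
Proof. by move=> /right_idealP pr; exact: (xgetPex _ pr). Qed.

Lemma ldiv_mul p r x : cancellative P -> right_ideal p r ->
  ldiv p (r * x)%g = (ldiv p r * x)%g.
Proof.
move=> [cancl _] pr; apply: (cancl p) => /=; rewrite mulgA !mul_ldiv//.
by apply/right_idealP; exists (ldiv p r * x)%g; rewrite mulgA mul_ldiv.
Qed.

Lemma right_ideal_trans p q r :
  right_ideal p q -> right_ideal q r -> right_ideal p r.
Proof.
move=> /mul_ldiv <- /mul_ldiv <-.
apply/right_idealP; exists (ldiv p q * ldiv (p * ldiv p q) r)%g.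
by rewrite mulgA.
Qed.

Lemma right_ideal_refl p : right_ideal p p.
Proof. by apply/right_idealP; exists 1%g; rewrite mulg1. Qed.

Lemma lcm_ofP p q r : right_LCM P -> right_ideal p r -> right_ideal q r ->
  right_ideal p `&` right_ideal q = right_ideal (lcm_of p q).
Proof.
move=> lcmP pr qr; case: (lcmP p q) => [pq0|ex]; last exact: (xgetPex _ ex).
by have : (right_ideal p `&` right_ideal q) r by []; rewrite pq0.
Qed.

End RightIdeals.

(** * The ideals [alpha_p(A)] *)

Section DynamicalSystem.
Context (R : realType) (A : cstarAlgType R) (P : monoidType).
Context (alpha : P -> {linear A -> A}).
Hypothesis sys : right_LCM_dynamical_system alpha.
Implicit Types (p : P) (a b : A).

Lemma alpha1_mul p a : alpha p 1 * alpha p a = alpha p a.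
Proof. by rewrite -(rlcm_mul sys) mul1r. Qed.

Lemma alpha1_mulr p a : alpha p a * alpha p 1 = alpha p a.
Proof. by rewrite -(rlcm_mul sys) mulr1. Qed.

(** A two-sided ideal containing a unit for itself has a central one: both
    [alpha_p(1) a] and [a alpha_p(1)] lie in [alpha_p(A)], so both equal
    [alpha_p(1) a alpha_p(1)]. *)
Lemma alpha1_central_projection p : central_projection (alpha p 1).
Proof.
have [_ _ _ idl idr] := rlcm_ideal sys p.
split; first by rewrite -(rlcm_mul sys) mulr1.
  by rewrite -(rlcm_star sys) star1.
move=> a; have Ep : range (alpha p) (alpha p 1) by exists 1.
have [b _ bE] := idl a _ Ep; have [c _ cE] := idr _ a Ep.
by rewrite -bE -(alpha1_mul p b) bE mulrA -cE alpha1_mulr.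
Qed.

Lemma alpha1_range p a : alpha p 1 * a = a -> exists b, alpha p b = a.
Proof.
have [_ _ _ _ idr] := rlcm_ideal sys p => <-.
have Ep : range (alpha p) (alpha p 1) by exists 1.
by have [b _ <-] := idr _ a Ep; exists b.
Qed.

Lemma alphaK p : cancel (alpha p) (alpha_inv alpha p).
Proof.
move=> b; apply: (rlcm_inj sys (p := p)).
by apply: (@xgetPex _ 0 [set c | alpha p c = alpha p b]); exists b.
Qed.

Lemma alpha_invK p a : alpha p 1 * a = a -> alpha p (alpha_inv alpha p a) = a.
Proof. by move=> /alpha1_range[b <-]; rewrite alphaK. Qed.

End DynamicalSystem.

(** * Positivity of the kernel system *)

Section KernelPositivity.
Context (R : realType) (A : cstarAlgType R) (P : monoidType).
Context (alpha : P -> {linear A -> A}) (H : hilbertType R).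
Context (phi : {linear A -> 'B(H)}) (T : P -> 'B(H)).
Hypothesis sys : right_LCM_dynamical_system alpha.
Hypothesis rep : contractive_covariant_representation alpha phi T.
Implicit Types (p q r : P) (a b e : A).

Local Notation K := (kernel_system alpha phi T).

(** The kernel may be computed from any common right multiple [r] of [p] and
    [q].  If [r = t s] with [t] the chosen generator of the intersection, then
    [alpha_t^-1 (alpha_r b) = alpha_s b], whose image under [phi] is
    [T(s) phi(b) T(s)^*] by covariance. *)
Lemma kernel_system_alpha p q r b : right_ideal p r -> right_ideal q r ->
  K p (alpha r b) q = T (ldiv p r) * phi b * adj (T (ldiv q r)).
Proof.
move=> pr qr.
have lcmE := lcm_ofP (rlcm_right_LCM sys) pr qr.
rewrite /kernel_system asboolF; last first.
  by move=> pq0; have : (right_ideal p `&` right_ideal q) r by []; rewrite pq0.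
have [pt qt] : (right_ideal p `&` right_ideal q) (lcm_of p q).
  by rewrite lcmE; exact: right_ideal_refl.
have tr : right_ideal (lcm_of p q) r by rewrite -lcmE.
rewrite /= -(mul_ldiv tr) !ldiv_mul//; [|exact: (rlcm_cancellative sys)..].
rewrite -(rlcm_comp sys) alphaK// !(ccr_TM rep) adjM.
by rewrite -(ccr_covariant rep) !mulrA.
Qed.

(** The support conditions place [a] and [b] in the range of [alpha_r], with [r]
    generating the intersection, where [alpha_r^-1] is additive. *)
Lemma kernel_systemD p q a b :
  alpha p 1 * a = a -> alpha q 1 * a = a ->
  alpha p 1 * b = b -> alpha q 1 * b = b ->
  K p (a + b) q = K p a q + K p b q.
Proof.
move=> pa qa pb qb.
have [pq0|[r pqr]] := rlcm_right_LCM sys p q.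
  by rewrite /kernel_system !asboolT// addr0.
have [pr qr] : (right_ideal p `&` right_ideal q) r.
  by rewrite pqr; exact: right_ideal_refl.
have in_range c : alpha p 1 * c = c -> alpha q 1 * c = c ->
    exists d, alpha r d = c.
  move=> pc qc; apply: (alpha1_range sys).
  by rewrite -(rlcm_lcm sys pqr) -mulrA qc pc.
have [[a' <-] [b' <-]] := (in_range a pa qa, in_range b pb qb).
by rewrite -raddfD !kernel_system_alpha// raddfD/= mulrDr mulrDl.
Qed.

Lemma kernel_system0 p q : K p 0 q = 0.
Proof.
by apply: (addrI (K p 0 q)); rewrite -kernel_systemD ?mulr0// !addr0.
Qed.

Lemma kernel_system1 a : K 1%g a 1%g = phi a.
Proof.
have ee := right_ideal_refl (1%g : P).
rewrite -{1}(rlcm_id sys a) kernel_system_alpha//.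
by rewrite -[ldiv _ _]mul1g mul_ldiv// (ccr_T1 rep) adj1 mul1r mulr1.
Qed.

Section Compression.
Variables (n : nat) (p : 'I_n -> P) (a : 'I_n -> A) (h : 'I_n -> H).
Hypothesis a_supp : forall i, alpha (p i) 1 * a i = a i.

Let E i := alpha (p i) 1.

(** The quadratic form of the kernel matrix at [h], with each entry
    [a_i^* a_j] cut down by [e]. *)
Definition compressed_form e : R[i] :=
  \sum_i dotp (\sum_j K (p i) (e * (star (a i) * a j)) (p j) (h j)) (h i).

Let E_central i : central_projection (E i).
Proof. exact: alpha1_central_projection. Qed.

Let supp_l e i j : central_projection e ->
  E i * (e * (star (a i) * a j)) = e * (star (a i) * a j).
Proof.
move=> [_ _ ec]; have [_ Es Ec] := E_central i.
rewrite mulrA -ec -mulrA; congr (_ * _); rewrite mulrA Ec -Es -star_mul.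
by rewrite a_supp.
Qed.

Let supp_r e i j : central_projection e ->
  E j * (e * (star (a i) * a j)) = e * (star (a i) * a j).
Proof.
move=> [_ _ ec]; have [_ _ Ec] := E_central j.
by rewrite Ec -!mulrA -Ec a_supp.
Qed.

Lemma compressed_formD e f : central_projection e -> central_projection f ->
  compressed_form (e + f) = compressed_form e + compressed_form f.
Proof.
move=> ce cf; rewrite -big_split; apply: eq_bigr => i _ /=.
rewrite -linearDl -big_split/=; congr (dotp _ _); apply: eq_bigr => j _ /=.
by rewrite mulrDl kernel_systemD ?supp_l ?supp_r.
Qed.

Lemma compressed_form0 : compressed_form 0 = 0.
Proof.
apply: (addrI (compressed_form 0)).
by rewrite -compressed_formD ?addr0//; exact: central_projection0.
Qed.

(** When [e] lies below [E_r] and every [p_i] either divides [r] or has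
    [E_(p_i) e = 0], this is the Gram form of the [b_i = alpha_r^-1 (e a_i)] at
    the vectors [T(p_i^-1 r)^* h_i]. *)
Lemma compressed_form_atom e r : gram_positive phi ->
  central_projection e -> alpha r 1 * e = e ->
  (forall i, right_ideal (p i) r \/ E i * e = 0) ->
  0 <= compressed_form e.
Proof.
move=> phi_gram [ee es ec] re dich.
pose b i := alpha_inv alpha r (e * a i).
have bE i : alpha r (b i) = e * a i.
  by apply: (alpha_invK sys); rewrite mulrA re.
pose S i := if `[< right_ideal (p i) r >] then T (ldiv (p i) r) else 0.
have b0 i : ~ right_ideal (p i) r -> b i = 0.
  move=> npr; case: (dich i) => // Ee0; apply: (rlcm_inj sys (p := r)).
  rewrite bE raddf0 -a_supp mulrA ec; have [_ _ Ec] := E_central i.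
  by rewrite -/(E i) Ee0 mul0r.
have KE i j : K (p i) (e * (star (a i) * a j)) (p j) =
    S i * phi (star (b i) * b j) * adj (S j).
  have -> : e * (star (a i) * a j) = alpha r (star (b i) * b j).
    rewrite (rlcm_mul sys) (rlcm_star sys) !bE star_mul es.
    by rewrite -mulrA (mulrA e e) ee [RHS]mulrA -ec -mulrA.
  rewrite /S; case: asboolP => [pr|/b0 ->]; last first.
    by rewrite star0 mul0r raddf0 kernel_system0 !mul0r.
  case: asboolP => [qr|/b0 ->]; first exact: kernel_system_alpha.
  by rewrite mulr0 !raddf0 kernel_system0 mulr0 mul0r.
have := phi_gram n b (fun i => adj (S i) (h i)).
congr (_ <= _); apply: eq_bigr => i _.
rewrite -adjP bop_sum; congr (dotp _ _); apply: eq_bigr => j _.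
by rewrite KE.
Qed.

(** Induction on the list [s] of indices not yet known to satisfy the dichotomy
    of the previous lemma: [e] splits as [E_k e + (e - E_k e)].  On the second
    part [E_k] vanishes.  The first part either vanishes or lies below [E_t],
    where [t] generates [p_k P `&` r P]; the [p_i] dividing [r] divide [t]
    too. *)
Lemma compressed_form_ge0 (s : seq 'I_n) e r : gram_positive phi ->
  central_projection e -> alpha r 1 * e = e ->
  (forall i, i \notin s -> right_ideal (p i) r \/ E i * e = 0) ->
  0 <= compressed_form e.
Proof.
move=> phi_gram; elim: s e r => [|k s IHs] e r ce re dich.
  by apply: compressed_form_atom ce re _ => // i; exact: dich.
have [ee es ec] := ce; have [EE Es Ec] := E_central k.
have cEe : central_projection (E k * e) by exact: central_projectionM.
have cBe : central_projection (e - E k * e).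
  by apply: central_projectionB => //; rewrite -mulrA ee.
rewrite -[e](subrKC (E k * e)) compressed_formD// addr_ge0//.
  have [pr0|[t prt]] := rlcm_right_LCM sys (p k) r.
    by rewrite -re mulrA (rlcm_disjoint sys pr0) mul0r compressed_form0.
  have [kt rt] : (right_ideal (p k) `&` right_ideal r) t.
    by rewrite prt; exact: right_ideal_refl.
  apply: (IHs _ t) => // [|i i_s].
    rewrite -(rlcm_lcm sys prt) -/(E k) -mulrA (mulrA _ (E k)).
    by rewrite -(Ec (alpha r 1)) -(mulrA (E k)) re mulrA EE.
  have [->|ik] := eqVneq i k; first by left.
  have [|ir|Eie0] := dich i; first by rewrite inE negb_or ik.
    by left; exact: right_ideal_trans ir rt.
  by right; rewrite Ec mulrA Eie0 mul0r.
apply: (IHs _ r) => // [|i i_s].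
  by rewrite mulrBr re mulrA -Ec -mulrA re.
have [->|ik] := eqVneq i k; first by right; rewrite mulrBr mulrA EE subrr.
have [|ir|Eie0] := dich i; first by rewrite inE negb_or ik.
  by left.
by right; rewrite mulrBr Eie0 Ec mulrA Eie0 mul0r subrr.
Qed.

End Compression.

Lemma kernel_positive_gram : gram_positive phi -> kernel_positive alpha K.
Proof.
move=> phi_gram n p a supp h.
have a_supp i : alpha (p i) 1 * a i = a i.
  have [b ->] := supp i.
  have [EE _ Ec] := alpha1_central_projection sys (p i).
  by rewrite Ec -mulrA EE.
suff -> : \sum_i dotp (\sum_j (\matrix_(i, j) K (p i) (star (a i) * a j) (p j))
    i j (h j)) (h i) = compressed_form p a h 1.
  apply: (compressed_form_ge0 h a_supp (s := enum 'I_n) (r := 1%g)) => //.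
  - by split; rewrite ?mulr1 ?star1// => b; rewrite mulr1 mul1r.
  - by rewrite (rlcm_id sys) mulr1.
  - by move=> i; rewrite mem_enum.
apply: eq_bigr => i _; congr (dotp _ _); apply: eq_bigr => j _.
by rewrite mxE mul1r.
Qed.

Lemma gram_kernel_positive : kernel_positive alpha K -> gram_positive phi.
Proof.
move=> K_pos n b h.
have : forall i, exists c, b i = c * alpha 1%g 1.
  by move=> i; exists (b i); rewrite (rlcm_id sys) mulr1.
move=> /(K_pos n (fun=> 1%g) b)/(_ h).
congr (_ <= _); apply: eq_bigr => i _; congr (dotp _ _); apply: eq_bigr => j _.
by rewrite mxE kernel_system1.
Qed.

End KernelPositivity.

Theorem proposition5p10 (R : realType) (A : cstarAlgType R) (P : monoidType)
    (alpha : P -> {linear A -> A}) (H : hilbertType R)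
    (phi : {linear A -> 'B(H)}) (T : P -> 'B(H)) :
  right_LCM_dynamical_system alpha ->
  contractive_covariant_representation alpha phi T ->
  (kernel_positive alpha (kernel_system alpha phi T) <->
   completely_positive phi).
Proof.
move=> sys rep; split=> [K_pos|/completely_positive_gram].
  apply/completely_positive_gram; exact: gram_kernel_positive K_pos.
exact: kernel_positive_gram.
Qed.
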